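(* Let $\gamma\in\overline{\mathbb{Q}}$ and let $S$ be a finite generating set of $\gamma$. Then, as ideals of $\overline{\mathbb{Z}}$, $\sqrt{\mathfrak{D}_\gamma}=\sqrt{\big(\prod_{\alpha\in S}\alpha\big)\overline{\mathbb{Z}}}$. Moreover, for every number field $K$, as ideals of $\mathcal{O}_K$, $\sqrt{\mathfrak{D}_\gamma\cap\mathcal{O}_K}=\prod_{\mathfrak{p}\in Y(K,\gamma)}\mathfrak{p}$ and $\sqrt{\big(\prod_{\alpha\in S\cap K}\alpha\big)\mathcal{O}_K}=\prod_{\mathfrak{p}\in X(K,\gamma)}\mathfrak{p}$.
   Context: $\overline{\mathbb{Z}}$ is the ring of algebraic integers and $\mathfrak{D}_\gamma=\{a\in\overline{\mathbb{Z}}: a\gamma\in\overline{\mathbb{Z}}\}$ (the denominator ideal). $X(K,\gamma)$ is the set of nonzero prime ideals $\mathfrak{p}$ of $\mathcal{O}_K$ such that every nonzero prime $\mathfrak{q}$ of $\mathcal{O}_{K(\gamma)}$ with $\mathfrak{q}\cap\mathcal{O}_K=\mathfrak{p}$ satisfies $v_{\mathfrak{q}}(\gamma)<0$; $Y(K,\gamma)$ is the set of nonzero prime ideals $\mathfrak{p}$ of $\mathcal{O}_K$ such that some such $\mathfrak{q}$ satisfies $v_{\mathfrak{q}}(\gamma)<0$. A subset $S\subseteq\overline{\mathbb{Z}}$ is a generating set of $\gamma$ if for every number field $L\subseteq\overline{\mathbb{Q}}$, $X(L,\gamma)=\{\mathfrak{q}\in\operatorname{Spec}(\mathcal{O}_L)\setminus\{0\}:\mathfrak{q}\cap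 S\neq\emptyset\}$. *)

(* Defs.v *)
From mathcomp Require Import all_boot all_order all_algebra all_field.
From mathcomp Require Import boolp.
Set Implicit Arguments. Unset Strict Implicit. Unset Printing Implicit Defensive.
Import Order.TTheory GRing.Theory Num.Theory.
Local Open Scope ring_scope.

Definition subsetC := algC -> Prop.

Definition Zbar : subsetC := fun x => x \in Aint.

Definition isSubfield (F : subsetC) : Prop :=
  F 0 /\ F 1 /\ (forall x y, F x -> F y -> F (x + y)) /\ (forall x, F x -> F (- x)) /\
  (forall x y, F x -> F y -> F (x * y)) /\ (forall x, F x -> x != 0 -> F x^-1).

Definition isNumberField (F : subsetC) : Prop :=
  isSubfield F /\
  exists bs : seq algC, forall x, F x ->
    exists rs : seq rat, x = \sum_(i < size bs) ratr (nth 0 rs i) * bs`_i.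

Definition adjoin (K : subsetC) (g : algC) : subsetC :=
  fun x => forall F, isSubfield F -> (forall y, K y -> F y) -> F g -> F x.

Definition ringOfIntegers (F : subsetC) : subsetC := fun x => F x /\ Zbar x.

Definition isIdeal (R I : subsetC) : Prop :=
  (forall x, I x -> R x) /\ I 0 /\ (forall x y, I x -> I y -> I (x + y)) /\
  (forall r x, R r -> I x -> I (r * x)).

Definition nzPrime (R I : subsetC) : Prop :=
  isIdeal R I /\ (exists x, I x /\ x != 0) /\ ~ I 1 /\
  (forall x y, R x -> R y -> I (x * y) -> I x \/ I y).

Definition sameIdeal (I J : subsetC) : Prop := forall x, I x <-> J x.

Definition idealMul (I J : subsetC) : subsetC :=
  fun x => exists s : seq (algC * algC),
    (forall p, p \in s -> I p.1 /\ J p.2) /\ x = \sum_(p <- s) p.1 * p.2.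

Fixpoint idealPow (R I : subsetC) (n : nat) : subsetC :=
  match n with
  | 0 => R
  | n.+1 => idealMul (idealPow R I n) I
  end.

Definition prodIdeals (R : subsetC) (ps : seq subsetC) : subsetC :=
  foldr idealMul R ps.

Definition radical (R I : subsetC) : subsetC :=
  fun x => R x /\ exists n : nat, (0 < n)%N /\ I (x ^+ n).

Definition principal (R : subsetC) (c : algC) : subsetC :=
  fun x => exists r, R r /\ x = c * r.

Definition denomIdeal (g : algC) : subsetC := fun a => Zbar a /\ Zbar (a * g).

(* v_q(g) < 0 for a nonzero prime q of R = O_L, g in L:
   writing g = a / b with a, b in O_L, b <> 0, one has v_q(a) < v_q(b),
   i.e. some power q^n contains b but not a. *)
Definition negVal (R q : subsetC) (g : algC) : Prop :=
  exists a b, R a /\ R b /\ b != 0 /\ g = a / b /\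
    exists n : nat, idealPow R q n b /\ ~ idealPow R q n a.

Definition liesOver (K q p : subsetC) : Prop :=
  forall x, (q x /\ ringOfIntegers K x) <-> p x.

Definition inX (K : subsetC) (g : algC) (p : subsetC) : Prop :=
  nzPrime (ringOfIntegers K) p /\
  forall q, nzPrime (ringOfIntegers (adjoin K g)) q -> liesOver K q p ->
    negVal (ringOfIntegers (adjoin K g)) q g.

Definition inY (K : subsetC) (g : algC) (p : subsetC) : Prop :=
  nzPrime (ringOfIntegers K) p /\
  exists q, nzPrime (ringOfIntegers (adjoin K g)) q /\ liesOver K q p /\
    negVal (ringOfIntegers (adjoin K g)) q g.

(* S (a finite set, given as a duplicate-free list) is a generating set of g *)
Definition generatingSet (S : seq algC) (g : algC) : Prop :=
  (forall a, a \in S -> Zbar a) /\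
  forall L, isNumberField L -> forall q,
    inX L g q <-> (nzPrime (ringOfIntegers L) q /\ exists a, a \in S /\ q a).

Definition idealDef : subsetC := fun _ => False.

Definition enumerates (P : subsetC -> Prop) (ps : seq subsetC) : Prop :=
  (forall i, (i < size ps)%N -> P (nth idealDef ps i)) /\
  (forall i j, (i < size ps)%N -> (j < size ps)%N ->
     sameIdeal (nth idealDef ps i) (nth idealDef ps j) -> i = j) /\
  (forall p, P p -> exists i, (i < size ps)%N /\ sameIdeal p (nth idealDef ps i)).

(* Main.v *)
From mathcomp Require Import all_boot all_order all_algebra all_field zify ring.
From mathcomp Require Import boolp classical_sets cardinality.
Require Import Defs.
Import Order.TTheory GRing.Theory Num.Theory.
Set Implicit Arguments. Unset Strict Implicit. Unset Printing Implicit Defensive.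
Local Open Scope ring_scope.

(** Let [f] be a primitive integer polynomial with [f(g) = 0].  Its Horner tails [D_j] at [g]
    satisfy [f_j = D_j - g D_(j+1)], and both [D_(j+1)] and [g D_(j+1)] are algebraic integers.
    Since [f] is primitive, a prime [q] containing the denominator ideal of [g] cannot contain all
    the [g D_(j+1)], so [g] is a quotient of an element outside [q] by an element of [q]: hence
    [v_q(g) < 0] exactly when [q] contains the denominator ideal, without any appeal to unique
    factorization.  In a ring of algebraic integers nonzero primes are maximal, so the radical of
    a nonzero ideal is the product of the finitely many primes above it, and the three identities
    reduce to comparing the primes above the two ideals involved. *)

(** * Integrality of Horner tails *)

Lemma primitive_int_poly (p : {poly rat}) : p != 0 ->
  exists (f : {poly int}) (c : rat),
    [/\ c != 0, p = c *: map_poly intr f & zcontents f = 1].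
Proof.
move=> p0; have [f [a a0 pE]] := rat_poly_scale p.
have f0 : f != 0 by apply: contra_neq p0 => f0; rewrite pE f0 rmorph0 scaler0.
exists (zprimitive f), (a%:~R^-1 * (zcontents f)%:~R); split.
- by rewrite mulf_neq0 ?invr_eq0 ?intr_eq0 // zcontents_eq0.
- by rewrite pE {1}[f]zpolyEprim map_polyZ scalerA.
- by rewrite zcontents_primitive f0.
Qed.

Lemma monic_int_root (x : algC) : x \in Aint ->
  exists f : {poly int}, [/\ f \is monic & root (map_poly intr f) x].
Proof.
rewrite unfold_in => /floorpP[f fE]; exists f; split; last first.
  by rewrite -fE root_minCpoly.
have := minCpoly_monic x; rewrite fE !monicE lead_coef_map_inj ?intr_inj //.
  by rewrite -[1](rmorph1 (intr : int -> algC)) (inj_eq intr_inj).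
by move=> a b /intr_inj.
Qed.

(** Transitivity of integrality: the coefficients are integral over the integers, hence so is a root
    of the monic [p]. *)
Lemma Aint_root_monic (p : {poly algC}) (x : algC) :
  p \is monic -> p \is a polyOver Aint -> root p x -> x \in Aint.
Proof.
move=> pm /polyOverP pZ px.
have: integralOver (intr : int -> algC) x.
  apply: (integral_root_monic pm px); apply/integral_poly => i.
  have [f [fm fi]] := monic_int_root (pZ i).
  by exists f.
case=> f fm fx; apply: (root_monic_Aint fx); first exact: monic_map.
by apply/polyOverP=> i; rewrite coef_map /= intr_int.
Qed.

(** Multiplying the relation by [c ^+ (n - 1)] gives a monic equation for [c * x]; for [n = 0] it
    forces [c = 0]. *)
Lemma Aint_lead_coef_mul (c x : algC) (n : nat) (p : {poly algC}) :
  c \in Aint -> p \is a polyOver Aint -> (size p <= n)%N ->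
  c * x ^+ n + p.[x] = 0 -> c * x \in Aint.
Proof.
case: n => [|n] cZ pZ sp px.
  move: sp px; rewrite leqn0 size_poly_eq0 => /eqP->.
  by rewrite horner0 addr0 expr0 mulr1 => ->; rewrite mul0r.
pose q : {poly algC} := \poly_(i < n.+1) (p`_i * c ^+ (n - i)).
have sq : (size q < size ('X^(n.+1) : {poly algC}))%N.
  by rewrite size_polyXn ltnS size_poly.
apply: (@Aint_root_monic ('X^(n.+1) + q)).
- by rewrite monicE lead_coefDl // lead_coefXn.
- rewrite rpredD ?rpredX ?polyOverX //.
  by apply: polyOver_poly => i _; rewrite rpredM ?rpredX ?(polyOverP pZ).
rewrite rootE hornerD hornerXn horner_poly.
have -> : \sum_(i < n.+1) p`_i * c ^+ (n - i) * (c * x) ^+ i = c ^+ n * p.[x].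
  rewrite (horner_coef_wide _ sp) mulr_sumr; apply: eq_bigr => i _.
  have ->: c ^+ n = c ^+ (n - i) * c ^+ i.
    by rewrite -exprD subnK // -ltnS.
  by rewrite exprMn !mulrA; congr (_ * _); rewrite -!mulrA mulrC -mulrA.
by rewrite exprMn exprS [c * _]mulrC -mulrA -mulrDr px mulr0.
Qed.

Lemma drop_poly_succ (R : comNzRingType) (f : {poly R}) (j : nat) (x : R) :
  (drop_poly j f).[x] = f`_j + x * (drop_poly j.+1 f).[x].
Proof.
have -> : drop_poly j f = (f`_j)%:P + drop_poly j.+1 f * 'X.
  apply/polyP => -[|i]; rewrite coefD coefC coefMX coef_drop_poly /=.
    by rewrite addr0 add0n.
  by rewrite coef_drop_poly add0r addSnnS.
by rewrite hornerD hornerC hornerMX mulrC.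
Qed.

Lemma Aint_horner_tail (f : {poly algC}) (x : algC) :
  f \is a polyOver Aint -> root f x ->
  forall j, (drop_poly j f).[x] \in Aint.
Proof.
move=> fZ fx j.
have dZ k : drop_poly k f \is a polyOver Aint.
  by apply/polyOverP => i; rewrite coef_drop_poly (polyOverP fZ).
have [le|/ltnW le] := leqP (size f) j.
  by rewrite drop_poly_eq0 // horner0.
rewrite -(subKn le).
elim: (size f - j)%N (leq_subr j (size f)) => [|k IH] kf.
  by rewrite subn0 drop_poly_eq0 // horner0.
rewrite drop_poly_succ rpredD ?(polyOverP fZ) // mulrC -(subSn kf) subSS.
(* Splitting [f] at index [size f - k] makes the tail there the leading coefficient of a relation
   for [x]; it is integral by induction, so its product with [x] is too. *)
apply: (@Aint_lead_coef_mul _ _ (size f - k) (take_poly (size f - k) f)).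
- exact/IH/ltnW.
- by apply/polyOverP => i; rewrite coef_take_poly; case: ifP; rewrite ?(polyOverP fZ).
- exact: size_take_poly.
have := poly_take_drop (size f - k) f => /(congr1 (horner^~ x)) /=.
by rewrite hornerD hornerM hornerXn (rootP fx) => <-; rewrite addrC.
Qed.

(** * Ideals in rings of algebraic integers *)

Lemma Bezout_prime (l : nat) (z : int) : prime l -> ~~ (l %| z)%Z ->
  exists u v : int, u%:~R * l%:R + v%:~R * z%:~R = 1 :> algC.
Proof.
move=> lp nd; have [u [v uv]] := Bezoutz l z; exists u, v.
rewrite [l%:R]pmulrn -!intrM -intrD uv /gcdz.
by have /eqP-> : coprime l `|z| by rewrite prime_coprime.
Qed.

(** Covers at once the rings of integers of subfields and the ring of all algebraic integers. *)
Record integralSubring (R : subsetC) : Prop := IntegralSubring {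
  isr1 : R 1;
  isrB : forall x y, R x -> R y -> R (x - y);
  isrM : forall x y, R x -> R y -> R (x * y);
  isrZ : forall x, R x -> x \in Aint }.

Section IntegralSubring.
Variables (R : subsetC).
Hypothesis isR : integralSubring R.

Lemma isr0 : R 0.
Proof. by rewrite -[0](subrr 1); apply: (isrB isR); apply: isr1. Qed.

Lemma isrN x : R x -> R (- x).
Proof. by move=> Rx; rewrite -sub0r; apply: (isrB isR isr0 Rx). Qed.

Lemma isrD x y : R x -> R y -> R (x + y).
Proof. by move=> Rx Ry; rewrite -[y]opprK; apply/(isrB isR Rx)/isrN. Qed.

Lemma isrX x n : R x -> R (x ^+ n).
Proof.
move=> Rx; elim: n => [|n IH]; rewrite ?expr0 ?exprS; first exact: isr1.
exact: isrM.
Qed.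

Lemma isr_nat (n : nat) : R n%:R.
Proof. by elim: n => [|n IH]; rewrite ?mulrS; [exact: isr0 | exact: isrD (isr1 isR) IH]. Qed.

Lemma isr_int (z : int) : R z%:~R.
Proof.
by case: z => n; [|rewrite NegzE rmorphN; apply: isrN]; apply: isr_nat.
Qed.

Lemma isr_horner (p : {poly int}) x : R x -> R (map_poly intr p).[x].
Proof.
move=> Rx; elim/poly_ind: p => [|p c IH]; first by rewrite rmorph0 horner0; apply: isr0.
rewrite rmorphD rmorphM /= map_polyX map_polyC hornerMXaddC.
by apply/isrD/isr_int; apply: isrM.
Qed.

Section Ideal.
Variable I : subsetC.
Hypothesis idI : isIdeal R I.

Lemma ideal_sub x : I x -> R x. Proof. by case: idI => + _; apply. Qed.
Lemma ideal0 : I 0. Proof. by case: idI => _ []. Qed.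
Lemma idealD x y : I x -> I y -> I (x + y). Proof. by case: idI => _ [_ []] + _; apply. Qed.
Lemma idealMl r x : R r -> I x -> I (r * x). Proof. by case: idI => _ [_ []] _; apply. Qed.
Lemma idealMr r x : R r -> I x -> I (x * r). Proof. by rewrite mulrC; apply: idealMl. Qed.
Lemma idealN x : I x -> I (- x).
Proof. by move=> Ix; rewrite -mulN1r; apply: (idealMl _ Ix); apply/isrN/(isr1 isR). Qed.
Lemma idealDr x y : I x -> I (x + y) -> I y.
Proof. by move=> Ix Ixy; rewrite -[y](addKr x); apply/idealD/Ixy/idealN. Qed.
Lemma ideal_sum (T : eqType) (s : seq T) (F : T -> algC) :
  (forall i, i \in s -> I (F i)) -> I (\sum_(i <- s) F i).
Proof. by move=> H; rewrite big_seq; apply: big_ind; [exact: ideal0|exact: idealD|]. Qed.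

(** The constant term of an integer polynomial vanishing at [x] is a multiple of [x] in [R]; as [x]
    is nonzero, dividing out powers of ['X] makes this term nonzero. *)
Lemma ideal_has_nz_int : (exists x, I x /\ x != 0) -> exists n : nat, (0 < n)%N /\ I n%:R.
Proof.
move=> [x [Ix x0]]; have Rx := ideal_sub Ix.
have [f [fm fx]] := monic_int_root (isrZ isR Rx).
have [m [g [fE g0]]] : exists m (g : {poly int}), f = g * 'X^m /\ g`_0 != 0.
  have [m [g]] := multiplicity_XsubC f 0.
  rewrite monic_neq0 //= => g0 ->; exists m, g; split; first by rewrite subr0.
  by rewrite -horner_coef0; apply: g0.
have gx : root (map_poly intr g) x.
  move: fx; rewrite fE rmorphM /= map_polyXn rootM => /orP[//|].
  by rewrite rootE hornerXn expf_eq0 (negbTE x0) andbF.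
have Ig0 : I (g`_0)%:~R.
  have := drop_poly_succ (map_poly intr g) 0 x.
  rewrite drop_poly0l (rootP gx) coef_map /= => /eqP.
  rewrite eq_sym addrC addr_eq0 => /eqP.
  move/(congr1 -%R); rewrite opprK => <-; apply: idealN.
  apply: (idealMr _ Ix).
  have -> : drop_poly 1 (map_poly intr g) = map_poly (intr : int -> algC) (drop_poly 1 g).
    by apply/polyP=> i; rewrite coef_drop_poly !coef_map /= coef_drop_poly.
  exact: isr_horner.
move: (g`_0) g0 Ig0 => c c0 pc; exists `|c|%N; split; first by rewrite absz_gt0.
have -> : `|c|%N%:R = ((sgz c)%:~R * c%:~R : algC) by rewrite -intrM -abszEsg.
exact: (idealMl (isr_int _) pc).
Qed.

End Ideal.

(** * Nonzero primes and the integers they contain *)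

Section Prime.
Variable p : subsetC.
Hypothesis pp : nzPrime R p.

Lemma prime_ideal : isIdeal R p. Proof. by case: pp. Qed.
Lemma prime_nz : exists x, p x /\ x != 0. Proof. by case: pp => _ []. Qed.
Lemma prime_not1 : ~ p 1. Proof. by case: pp => _ [_ []]. Qed.
Lemma primeM x y : R x -> R y -> p (x * y) -> p x \/ p y.
Proof. by case: pp => _ [_ []] _; apply. Qed.
Lemma primeX x n : R x -> p (x ^+ n) -> p x.
Proof.
move=> Rx; elim: n => [|n IH]; first by rewrite expr0 => /prime_not1.
by rewrite exprS => /primeM[]//; exact: isrX.
Qed.
Lemma prime_prod (T : eqType) (s : seq T) (P : pred T) (F : T -> algC) :
  (forall i, i \in s -> P i -> R (F i)) -> p (\prod_(i <- s | P i) F i) ->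
  exists i, [/\ i \in s, P i & p (F i)].
Proof.
elim: s => [|i s IH] sR; first by rewrite big_nil => /prime_not1.
have sR' j : j \in s -> P j -> R (F j) by move=> js; apply: sR; rewrite inE js orbT.
have {}IH : p (\prod_(i <- s | P i) F i) -> exists j, [/\ j \in i :: s, P j & p (F j)].
  by move=> /(IH sR')[j [js Pj pj]]; exists j; rewrite inE js orbT.
rewrite big_cons; case: ifP => // Pi /primeM[].
- exact/sR/Pi/mem_head.
- rewrite big_seq_cond; apply: (big_ind R) => [|x y|j /andP[]]; [exact: isr1|exact: isrM|].
  exact: sR'.
- by move=> pi; exists i; rewrite mem_head.
- exact: IH.
Qed.

(** Strong induction on a positive integer in [p]: its least prime factor or the smaller cofactor
    lies in [p]. *)
Lemma prime_has_prime : exists l : nat, prime l /\ p l%:R.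
Proof.
have [n [n0 pn]] := ideal_has_nz_int prime_ideal prime_nz.
elim/ltn_ind: n n0 pn => n IH n0 pn.
have n1 : (1 < n)%N.
  by case: n n0 pn {IH} => [//|[|//]] _ /prime_not1.
have [m nE] := dvdnP (pdiv_dvd n).
have pr := pdiv_prime n1.
move: (pn); rewrite {1}nE natrM => /primeM[]; [exact: isr_nat|exact: isr_nat| |].
  apply: IH; first by move: (prime_gt1 pr); nia.
  by case: m nE => // /esym e; rewrite -e in n0.
by exists (pdiv n).
Qed.

Lemma prime_int_dvd (l : nat) (z : int) : prime l -> p l%:R -> p z%:~R -> (l %| z)%Z.
Proof.
move=> lp pl pz; have idp := prime_ideal.
apply: contra_notT (prime_not1) => nd.
have [u [v <-]] := Bezout_prime lp nd.
by apply: (idealD idp); apply: (idealMl idp) => //; apply: isr_int.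
Qed.

End Prime.
End IntegralSubring.

(** * Maximality of nonzero primes, radicals and products *)

Section Primes.
Variables (R : subsetC).
Hypothesis isR : integralSubring R.

(* A monic integer polynomial [f] of least degree with [f(x)] in [p] has [f(0)] prime to [p]. *)
Lemma prime_maximal p x : nzPrime R p -> R x -> ~ p x ->
  exists y, R y /\ p (1 - x * y).
Proof.
move=> pp Rx npx; have idp := prime_ideal pp.
have [l [lp pl]] := prime_has_prime isR pp.
have [f [fm fx]] := monic_int_root (isrZ isR Rx).
have {fx} : p (map_poly intr f).[x] by rewrite (rootP fx); apply: (ideal0 idp).
have [n sf] : exists n, (size f <= n)%N by exists (size f).
elim: n f fm sf => [|n IH] f fm sf pf.
  by move: sf; rewrite leqn0 size_poly_eq0 (negbTE (monic_neq0 fm)).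
have fE : f = drop_poly 1 f * 'X + (f`_0)%:P.
  apply/polyP => -[|i]; rewrite coefD coefC coefMX /= ?add0r //.
  by rewrite coef_drop_poly addn1 addr0.
set g := drop_poly 1 f in fE; set c := f`_0 in fE.
have fxE : (map_poly intr f).[x] = (map_poly intr g).[x] * x + c%:~R :> algC.
  by rewrite {1}fE rmorphD rmorphM /= map_polyX map_polyC hornerMXaddC.
have Rg := isr_horner isR g Rx.
(* If [p] contains [c], it contains [g(x) * x], hence [g(x)], where [g] is monic of smaller
   degree. *)
have [pc|npc] := pselect (p (c%:~R)).
  have : p ((map_poly intr g).[x] * x).
    by move: pf; rewrite fxE addrC; apply: (idealDr isR idp).
  case/(primeM pp) => // pg.
  have g0 : g != 0.
    apply/eqP => g0; move: fm; rewrite fE g0 mul0r add0r => /monicP.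
    rewrite lead_coefC => c1; apply: (prime_not1 pp).
    by move: pc; rewrite c1.
  apply: (IH g) => //.
    have sc : (size c%:P < size (g * 'X)%R)%N.
      by rewrite size_polyC size_mulX // ltnS (leq_trans (leq_b1 _)) // size_poly_gt0.
    by move: fm; rewrite fE !monicE lead_coefDl // lead_coefMX.
  by move: sf; rewrite {1}fE size_MXaddC (negbTE g0).
have lc : ~~ (l %| c)%Z.
  apply: contra_notN npc => /dvdzP[m ->]; rewrite intrM.
  by apply: (idealMl idp) => //; apply: (isr_int isR).
(* From [u l + v c = 1] and [c = f(x) - g(x) x], the inverse of [x] modulo [p] is [- v g(x)]. *)
have [u [v uv]] := Bezout_prime lp lc.
exists (- v%:~R * (map_poly intr g).[x]); split.
  by apply: (isrM isR) => //; apply: (isrN isR); apply: (isr_int isR).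
have -> : 1 - x * (- v%:~R * (map_poly intr g).[x])
   = u%:~R * l%:R + v%:~R * (map_poly intr f).[x].
  by rewrite fxE -[X in X - _]uv; ring.
by apply: (idealD idp); apply: (idealMl idp) => //; apply: (isr_int isR).
Qed.

Lemma prime_sub_eq p q : nzPrime R p -> nzPrime R q -> (forall x, p x -> q x) ->
  p = q.
Proof.
move=> pp pq sub; apply/funext => x; apply/propext; split; first exact: sub.
move=> qx; apply: contrapT => npx.
have Rx := ideal_sub (prime_ideal pq) qx.
have [y [Ry /sub q1]] := prime_maximal pp Rx npx.
have idq := prime_ideal pq.
apply: (prime_not1 pq); rewrite -[1](subrK (x * y)).
by apply: (idealD idq) => //; apply: (idealMr idq).
Qed.

Lemma prime_not_sub p q : nzPrime R p -> nzPrime R q -> p <> q ->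
  exists x, p x /\ ~ q x.
Proof.
move=> pp pq neq; apply: contrapT => nex; apply: neq; apply: prime_sub_eq => //.
by move=> x px; apply: contrapT => nqx; apply: nex; exists x.
Qed.

Lemma ideal_adjoin_elt I x : isIdeal R I -> R x ->
  isIdeal R (fun z => exists i r, [/\ I i, R r & z = i + r * x]).
Proof.
move=> idI Rx; split; [|split; [|split]].
- move=> _ [i [r [Ii Rr ->]]]; apply: (isrD isR); last exact: (isrM isR).
  exact: (ideal_sub idI).
- exists 0, 0; rewrite mul0r addr0; split => //; first exact: (ideal0 idI).
  exact: (isr0 isR).
- move=> _ _ [i [r [Ii Rr ->]]] [j [s [Ij Rs ->]]]; exists (i + j), (r + s).
  by rewrite mulrDl addrACA; split => //; [exact: (idealD idI)|exact: (isrD isR)].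
- move=> s _ Rs [i [r [Ii Rr ->]]]; exists (s * i), (s * r).
  by rewrite mulrDr mulrA; split => //; [exact: (idealMl idI)|exact: (isrM isR)].
Qed.

(** Krull's argument: an ideal maximal among those containing [I] and avoiding the multiplicative
    set [T] is prime. Here [T] will be the powers of an element, the complement of a prime in a
    subring, or [{1}]. *)
Lemma exists_prime_disjoint I T : isIdeal R I -> (exists x, I x /\ x != 0) ->
  (forall x, T x -> R x) -> T 1 -> (forall x y, T x -> T y -> T (x * y)) ->
  (forall x, I x -> ~ T x) ->
  exists q, [/\ nzPrime R q, forall x, I x -> q x & forall x, q x -> ~ T x].
Proof.
move=> idI [w [Iw w0]] TR T1 TM IT.
pose ok (A : subsetC) :=
  [/\ isIdeal R A, forall x, I x -> A x & forall x, A x -> ~ T x].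
(* the empty set is admitted so that the empty chain has an upper bound *)
pose P : set (set algC) := fun A => A = set0 \/ ok A.
have [F FP Ftot|Q [PQ Qmax]] := Zorn_bigcup (P := P).
  have [[A [FA A0]]|nex] := pselect (exists A, F A /\ A <> set0); last first.
    left; apply/seteqP; split=> // x [A FA Ax]; apply: nex; exists A; split=> // A0.
    by move: Ax; rewrite A0.
  have okF B x : F B -> B x -> ok B.
    by move=> FB Bx; case: (FP _ FB) => // B0; move: Bx; rewrite B0.
  have {A0} okA : ok A by case: (FP _ FA).
  right; split; first (split; [|split; [|split]]).
  - by move=> x [B FB Bx]; have [+ _ _] := okF _ _ FB Bx; move/ideal_sub; apply.
  - by exists A => //; have [+ _ _] := okA; apply: ideal0.
  - move=> x y [B FB Bx] [C FC Cy].
    have [idB _ _] := okF _ _ FB Bx; have [idC _ _] := okF _ _ FC Cy.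
    have [BC|CB] := Ftot _ _ FB FC.
      by exists C => //; apply: (idealD idC) => //; apply: BC.
    by exists B => //; apply: (idealD idB) => //; apply: CB.
  - move=> r x Rr [B FB Bx]; exists B => //.
    by have [idB _ _] := okF _ _ FB Bx; apply: (idealMl idB).
  - by move=> x Ix; exists A => //; have [_ + _] := okA; apply.
  - by move=> x [B FB Bx]; have [_ _] := okF _ _ FB Bx; apply.
have okI : ok I by split.
have okQ : ok Q.
  case: PQ => // Q0; exfalso; apply: (Qmax I); last by right.
  by rewrite Q0; split=> // /(_ w Iw).
have [idQ IQ QT] := okQ; exists Q; split=> //.
(* By maximality, [Q + R x] meets [T] as soon as [x] is outside [Q]. *)
have adj x : R x -> ~ Q x -> exists i r, [/\ Q i, R r & T (i + r * x)].
  move=> Rx nQx; apply: contrapT => nex.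
  have sub y : Q y -> exists i r, [/\ Q i, R r & y = i + r * x].
    by move=> Qy; exists y, 0; rewrite mul0r addr0; split => //; apply: (isr0 isR).
  apply: (Qmax (fun z => exists i r, [/\ Q i, R r & z = i + r * x])).
    split; first exact: sub.
    move=> /(_ x) H; apply: nQx; apply: H; exists 0, 1; rewrite add0r mul1r; split=> //.
      exact: (ideal0 idQ).
    exact: isr1.
  right; split; first exact: ideal_adjoin_elt.
    by move=> y /IQ/sub.
  by move=> _ [i [r [Qi Rr ->]]] Tz; apply: nex; exists i, r.
split=> //; split; first by exists w; split=> //; apply: IQ.
split; first by move=> /QT.
(* If [x] and [y] were both outside [Q], an element of [T] in [Q + R x] times one in [Q + R y] would
   lie in [Q + R x y], which is [Q]. *)
move=> x y Rx Ry Qxy; apply: contrapT => /not_orP[/(adj _ Rx)[i [r [Qi Rr Tx]]]].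
move=> /(adj _ Ry)[j [s [Qj Rs Ty]]]; apply: (QT ((i + r * x) * (j + s * y))); last exact: TM.
rewrite mulrDl; apply: (idealD idQ).
  by apply: (idealMr idQ) => //; apply/TR.
rewrite mulrDr; apply: (idealD idQ).
  by apply: (idealMl idQ) => //; apply: (isrM isR).
by rewrite mulrACA; apply: (idealMl idQ) => //; apply: (isrM isR).
Qed.

(** If no positive power of [x] lies in [I], some prime over [I] avoids all powers of [x]. *)
Lemma radicalP I x : isIdeal R I -> (exists y, I y /\ y != 0) -> R x ->
  radical R I x <-> (forall p, nzPrime R p -> (forall y, I y -> p y) -> p x).
Proof.
move=> idI nzI Rx; split.
  by move=> [_ [n [_ Ixn]]] p pp Ip; apply: (primeX isR pp Rx (n := n)); apply: Ip.
move=> H; split => //; apply: contrapT => nrad.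
have [||||q [pq Iq qT]] := @exists_prime_disjoint I (fun y => exists n, y = x ^+ n) idI nzI.
- by move=> _ [n ->]; apply: (isrX isR).
- by exists 0%N; rewrite expr0.
- by move=> _ _ [n ->] [m ->]; exists (n + m)%N; rewrite exprD.
(* The set of powers includes exponent 0 while [radical] asks for a positive one, hence [n.+1]. *)
- move=> y Iy [n yE]; apply: nrad; exists n.+1; split => //.
  by rewrite exprS -yE; apply: (idealMl idI).
by apply: (qT x); [exact: H | exists 1%N; rewrite expr1].
Qed.

Lemma idealMul_ideal I J : isIdeal R I -> isIdeal R J -> isIdeal R (idealMul I J).
Proof.
move=> idI idJ; split; [|split; [|split]].
- move=> _ [s [sP ->]]; rewrite big_seq.
  apply: (big_ind R) => [|x y|i /sP[Ii Ji]]; [exact: (isr0 isR)|exact: (isrD isR)|].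
  by apply: (isrM isR); [exact: (ideal_sub idI)|exact: (ideal_sub idJ)].
- by exists [::]; rewrite big_nil.
- move=> _ _ [s [sP ->]] [t [tP ->]]; exists (s ++ t); rewrite big_cat; split => // i.
  by rewrite mem_cat => /orP[/sP|/tP].
- move=> r _ Rr [s [sP ->]]; exists [seq (r * i.1, i.2) | i <- s]; split.
    by move=> _ /mapP[i /sP[Ii Ji] ->] /=; split => //; apply: (idealMl idI).
  by rewrite mulr_sumr big_map; apply: eq_bigr => i _; rewrite mulrA.
Qed.

Lemma ideal_ring : isIdeal R R.
Proof.
by split => //; split; [exact: (isr0 isR)|split; [exact: (isrD isR)|exact: (isrM isR)]].
Qed.

Lemma idealMul_mem (I J : subsetC) x y : I x -> J y -> idealMul I J (x * y).
Proof.
by move=> Ix Jy; exists [:: (x, y)]; rewrite big_seq1; split => // _ /[!inE]/eqP->.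
Qed.

Lemma idealMul_sub_r I J x : isIdeal R I -> isIdeal R J -> idealMul I J x -> J x.
Proof.
move=> idI idJ [s [sP ->]]; apply: (ideal_sum idJ) => i /sP[Ii Ji].
by apply: (idealMl idJ) => //; apply: (ideal_sub idI).
Qed.

Lemma idealMul_sub_l I J x : isIdeal R I -> isIdeal R J -> idealMul I J x -> I x.
Proof.
move=> idI idJ [s [sP ->]]; apply: (ideal_sum idI) => i /sP[Ii Ji].
by apply: (idealMr idI) => //; apply: (ideal_sub idJ).
Qed.

(** The type [{classic subsetC}] carries a classical decidable equality, so that [\in] and [uniq]
    apply to lists of ideals. *)
Lemma prodIdeals_ideal (ps : seq {classic subsetC}) : (forall p, p \in ps -> isIdeal R p) ->
  isIdeal R (prodIdeals R ps).
Proof.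
elim: ps => [|p ps IH] idp /=; first exact: ideal_ring.
by apply: idealMul_ideal; [apply/idp/mem_head|apply: IH => q qs; apply: idp; rewrite inE qs orbT].
Qed.

(** Distinct nonzero primes are incomparable, so each factor supplies an element outside [q]; the
    product of these stays outside [q]. *)
Lemma prodIdeals_not_sub (ps : seq {classic subsetC}) q : nzPrime R q ->
  (forall p, p \in ps -> nzPrime R p /\ p <> q) ->
  exists x, prodIdeals R ps x /\ ~ q x.
Proof.
move=> pq; elim: ps => [|p ps IH] H /=.
  by exists 1; split; [exact: isr1|exact: (prime_not1 pq)].
have [pp neq] := H p (mem_head _ _).
have [x [px nqx]] := prime_not_sub pp pq neq.
have {}H : forall p0, p0 \in ps -> nzPrime R p0 /\ p0 <> q.
  by move=> p0 p0s; apply: H; rewrite inE p0s orbT.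
have [y [psy nqy]] := IH H.
have idps : isIdeal R (prodIdeals R ps).
  by apply: prodIdeals_ideal => p0 /H[/prime_ideal].
exists (x * y); split; first exact: idealMul_mem.
move=> /(primeM pq)[]//; [exact: (ideal_sub (prime_ideal pp))|exact: (ideal_sub idps)].
Qed.

(** Distinct maximal ideals are pairwise coprime, so their product is their intersection. *)
Lemma prodIdealsP (ps : seq {classic subsetC}) x : (forall p, p \in ps -> nzPrime R p) -> uniq ps ->
  R x -> prodIdeals R ps x <-> (forall p, p \in ps -> p x).
Proof.
move=> + + Rx; elim: ps => [|p ps IH] H /=; first by split.
move=> /andP[pnin nd].
have pp : nzPrime R p by apply/H/mem_head.
have idp := prime_ideal pp.
have {}H q : q \in ps -> nzPrime R q by move=> qs; apply: H; rewrite inE qs orbT.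
have idps : isIdeal R (prodIdeals R ps).
  by apply: prodIdeals_ideal => q /H/prime_ideal.
split.
  move=> pxs q; rewrite inE => /predU1P[->|qs]; first exact: idealMul_sub_l pxs.
  by move: q qs; apply/IH => //; apply: idealMul_sub_r pxs.
move=> xs; have px : p x by exact: (xs p (mem_head _ _)).
have psx : prodIdeals R ps x by apply/IH => // q qs; apply: (xs q); rewrite inE qs orbT.
have [|t [pst npt]] := prodIdeals_not_sub pp (ps := ps).
  by move=> q qs; split; [exact: H|move=> qp; move: pnin; rewrite -qp qs].
have [y [Ry p1]] := prime_maximal pp (ideal_sub idps pst) npt.
(* [1 - t * y] is in [p] and [t * y] in the product of the other primes, while [x] lies in both. *)
have -> : x = (1 - t * y) * x + x * (t * y) by rewrite mulrBl mul1r [x * _]mulrC subrK.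
apply: (idealD (idealMul_ideal idp idps)); apply: idealMul_mem => //.
exact: (idealMr idps).
Qed.

(** By extensionality [sameIdeal] is equality, so the indexed definition reduces to a duplicate-free
    list. *)
Lemma enumeratesP P (ps : seq {classic subsetC}) :
  enumerates P ps <-> uniq ps /\ forall p, p \in ps <-> P p.
Proof.
have eqI I J : sameIdeal I J -> I = J by move=> IJ; apply/funext => x; apply/propext.
split=> [[psP [psI Pps]]|[ups psP]].
  split; first by apply/(uniqP idealDef) => i j si sj eij; apply: psI => // x; rewrite eij.
  move=> p; split; first by move=> /(nthP idealDef)[i si <-]; apply: psP.
  by move=> /Pps[i [si /eqI->]]; apply: mem_nth.
split; first by move=> i si; apply/psP/mem_nth.
split; first by move=> i j si sj /eqI/eqP; rewrite nth_uniq // => /eqP.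
move=> p /psP pps; exists (index (p : {classic subsetC}) ps); rewrite index_mem; split => //.
by rewrite nth_index.
Qed.

Lemma enumerates_radical I P ps : isIdeal R I -> (exists y, I y /\ y != 0) ->
  (forall p, P p <-> nzPrime R p /\ forall y, I y -> p y) ->
  enumerates P ps -> sameIdeal (radical R I) (prodIdeals R ps).
Proof.
move=> idI nzI PE /enumeratesP[ups psP] x.
have psp p : p \in (ps : seq {classic subsetC}) -> nzPrime R p by move=> /psP/PE[].
have [Rx|nRx] := pselect (R x); last first.
  split; first by case.
  by move/(ideal_sub (prodIdeals_ideal (fun p h => prime_ideal (psp p h)))).
rewrite radicalP // prodIdealsP //; split=> H p; first by move=> /psP/PE[]; apply: H.
by move=> pp Ip; apply: (H p); apply/psP/PE.
Qed.

Lemma exists_enumeration (P : subsetC -> Prop) :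
  finite_set (P : set subsetC) -> exists ps, enumerates P ps.
Proof.
move=> /(@finite_seqP {classic subsetC})[s sE]; exists (undup s); apply/enumeratesP.
split; first exact: undup_uniq.
by move=> p; rewrite mem_undup sE; split.
Qed.
End Primes.

(** * Finiteness of the set of primes over a nonzero ideal *)

Section Finiteness.
Variables (R : subsetC) (bs : seq algC).
Hypothesis isR : integralSubring R.
Hypothesis spanR : forall x, R x ->
  exists rs : seq rat, x = \sum_(i < size bs) ratr (nth 0 rs i) * bs`_i.

(* Elements [e_i] lying in every [p_j] but [p_i] are linearly independent: a primitive integer
   relation between them has all its coefficients divisible by [l]. *)
Lemma primes_over_prime_le (l : nat) (m : nat) (p : 'I_m -> subsetC) : prime l ->
  (forall i, nzPrime R (p i) /\ p i l%:R) -> injective p -> (m <= size bs)%N.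
Proof.
move=> lp pP pinj; rewrite leqNgt; apply/negP => ltm.
(* [e i] is taken in the product of the primes other than [p i], which is not contained in [p i]. *)
have /choice[e eP] i : exists y, R y /\ ~ p i y /\ forall j, j != i -> p j y.
  pose ps : seq {classic subsetC} := [seq p j | j <- enum 'I_m & j != i].
  have psP q : q \in ps -> nzPrime R q /\ q <> p i.
    move=> /mapP[j]; rewrite mem_filter => /andP[ji _] ->; split; first by case: (pP j).
    by move=> /pinj /eqP; apply/negP.
  have [x [xps nx]] := prodIdeals_not_sub isR (pP i).1 psP.
  have Rx : R x.
    by apply: ideal_sub xps; apply: prodIdeals_ideal => // q /psP[/prime_ideal].
  exists x; split => //; split => // j ji.
  have psN q (h : q \in ps) : nzPrime R q := (psP q h).1.
  have ups : uniq ps.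
    by rewrite map_inj_uniq => [|j1 j2 /pinj//]; apply/filter_uniq/enum_uniq.
  have [/(_ xps) psx _] := prodIdealsP isR psN ups Rx.
  apply: (psx (p j)); apply/mapP; exists j => //.
  by rewrite mem_filter ji mem_enum.
have /choice[rs rsP] i : exists r : seq rat,
    e i = \sum_(k < size bs) ratr (nth 0 r k) * bs`_k.
  by apply: spanR; case: (eP i).
pose M := \matrix_(i < m, k < size bs) nth 0 (rs i) k.
(* [M] has more rows than columns, so its rows satisfy a nontrivial rational relation. *)
have : kermx M != 0.
  rewrite -mxrank_eq0 mxrank_ker subn_eq0 -ltnNge.
  exact: leq_ltn_trans (rank_leq_col M) ltm.
move=> /rowV0Pn[u /sub_kermxP uM u0].
have ue : \sum_i ratr (u 0 i) * e i = 0.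
  under eq_bigr => i _ do rewrite rsP mulr_sumr.
  rewrite exchange_big big1 // => k _.
  have /(congr1 (fun A : 'rV_(size bs) => A 0 k)) := uM; rewrite !mxE.
  move=> /(congr1 (ratr : rat -> algC)); rewrite rmorph0 rmorph_sum /= => uk.
  rewrite -[RHS](mul0r bs`_k) -[X in X * _]uk mulr_suml; apply: eq_bigr => i _.
  by rewrite !mxE rmorphM mulrA.
(* Packing [u] as a polynomial lets its primitive part supply integer coefficients of content 1. The
   default 0 is never read. *)
pose U := \poly_(i < m) (if insub i is Some j then u 0 j else 0).
have UE (i : 'I_m) : U`_i = u 0 i by rewrite coef_poly ltn_ord valK.
have U0 : U != 0.
  by apply: contraNneq u0 => U0; apply/eqP/rowP => i; rewrite -UE U0 coef0 mxE.
have [f [c [c0 Uf f1]]] := primitive_int_poly U0.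
have Ufi i : U`_i = c * (f`_i)%:~R by rewrite Uf coefZ coef_map.
have fe : \sum_(i < m) (f`_i)%:~R * e i = 0.
  have rc0 : ratr c != 0 :> algC by rewrite fmorph_eq0.
  apply: (mulfI rc0); rewrite mulr0 -[RHS]ue mulr_sumr; apply: eq_bigr => i _.
  by rewrite -UE Ufi rmorphM /= ratr_int mulrA.
suff : (l %| zcontents f)%Z.
  by rewrite f1 dvdzE /= dvdn1 => /eqP l1; rewrite l1 in lp.
rewrite dvdz_contents; apply/polyOverP => i.
have [im|im] := ltnP i m; last first.
  suff -> : f`_i = 0 by exact: dvdz0.
  apply/eqP; rewrite -(intr_eq0 rat); apply/eqP/(mulfI c0).
  by rewrite mulr0 -Ufi coef_poly ltnNge im.
pose i' := Ordinal im; have [pi pil] := pP i'; have idp := prime_ideal pi.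
have [Re [npe _]] := eP i'.
suff : p i' ((f`_i)%:~R) by apply: (prime_int_dvd isR pi lp pil).
(* All other terms of the relation lie in [p i'], hence so does this one, although [e i'] does
   not. *)
have : p i' ((f`_i)%:~R * e i').
  move: fe; rewrite (bigD1 i') //= => /eqP; rewrite addr_eq0 => /eqP->.
  apply: (idealN isR idp); apply: (big_ind (p i')).
  - exact: (ideal0 idp).
  - exact: (idealD idp).
  move=> j ji; apply: (idealMl idp); first exact: (isr_int isR).
  by case: (eP j) => _ [_]; apply; rewrite eq_sym.
by move=> /(primeM pi)[]//; apply: (isr_int isR).
Qed.

Lemma finite_primes_over_prime (l : nat) : prime l ->
  finite_set ((fun p => nzPrime R p /\ p l%:R) : set subsetC).
Proof.
move=> lp; apply: contrapT => /infiniteP/pcard_leP/injfunPex[f fP finj].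
suff : (size bs < size bs)%N by rewrite ltnn.
apply: (@primes_over_prime_le l _ (fun i : 'I_(size bs).+1 => f i) lp).
  by move=> i; apply: fP.
by move=> i j /finj ij; apply/val_inj/ij; rewrite in_setE.
Qed.

Lemma finite_primes_over (n : nat) : (0 < n)%N ->
  finite_set ((fun p => nzPrime R p /\ p n%:R) : set subsetC).
Proof.
elim/ltn_ind: n => n IH n0.
have [n1|n1] := leqP n 1%N.
  have -> : n = 1%N by lia.
  by apply: (sub_finite_set (B := set0)) => // p [/prime_not1].
have [m nE] := dvdnP (pdiv_dvd n); have pr := pdiv_prime n1.
have m0 : (0 < m)%N by case: m nE => // nE; rewrite nE in n0.
have mn : (m < n)%N by move: (prime_gt1 pr); nia.
have := conj (IH m mn m0) (finite_primes_over_prime pr); rewrite -finite_setU.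
apply: sub_finite_set => p [pp]; rewrite {1}nE natrM => /(primeM pp)[]; try exact: (isr_nat isR).
  by left.
by right.
Qed.

Lemma enumeration_primes_over I : isIdeal R I -> (exists x, I x /\ x != 0) ->
  exists ps, enumerates (fun p => nzPrime R p /\ forall y, I y -> p y) ps.
Proof.
move=> idI /(ideal_has_nz_int isR idI)[n [n0 In]]; apply: exists_enumeration.
apply: sub_finite_set (finite_primes_over n0) => p [pp Ip].
by split => //; apply: Ip.
Qed.

End Finiteness.

(** * The denominator ideal and negative valuations *)

Local Notation "''O_' K" := (ringOfIntegers K) (at level 8, K at level 2, format "''O_' K").

Lemma isr_ringOfIntegers (F : subsetC) : isSubfield F -> integralSubring 'O_F.
Proof.
move=> [F0 [F1 [FD [FN [FM FV]]]]]; split.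
- by split => //; apply: Aint1.
- by move=> x y [Fx Zx] [Fy Zy]; split; [apply/FD/FN|apply: rpredB].
- by move=> x y [Fx Zx] [Fy Zy]; split; [apply: FM|apply: rpredM].
- by move=> x [].
Qed.

Lemma isSubfield_adjoin (K : subsetC) (g : algC) : isSubfield (adjoin K g).
Proof.
split; first by move=> F [? _].
split; first by move=> F [_ [? _]].
split.
  move=> x y Hx Hy F FF KF Fg; have [_ [_ [FD _]]] := FF.
  by apply: FD; [apply: Hx|apply: Hy].
split.
  by move=> x Hx F FF KF Fg; have [_ [_ [_ [FN _]]]] := FF; apply: FN; apply: Hx.
split.
  move=> x y Hx Hy F FF KF Fg; have [_ [_ [_ [_ [FM _]]]]] := FF.
  by apply: FM; [apply: Hx|apply: Hy].
move=> x Hx x0 F FF KF Fg; have [_ [_ [_ [_ [_ FV]]]]] := FF.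
by apply: FV => //; apply: Hx.
Qed.

Lemma sub_adjoin (K : subsetC) (g : algC) x : K x -> adjoin K g x.
Proof. by move=> Kx F _ KF _; apply: KF. Qed.

Lemma adjoin_mem (K : subsetC) (g : algC) : adjoin K g g.
Proof. by []. Qed.

Lemma adjoin_id (K : subsetC) (g : algC) : isSubfield K -> K g -> adjoin K g = K.
Proof.
move=> FK Kg; apply/funext => x; apply/propext; split; last exact: sub_adjoin.
by apply.
Qed.

Lemma isSubfield_top : isSubfield (fun=> True).
Proof. by []. Qed.

(** Lets the results on ['O_F] apply to the ring of all algebraic integers. *)
Lemma Zbar_top : 'O_(fun=> True) = Zbar.
Proof. by apply/funext => x; apply/propext; split => // -[]. Qed.

Lemma exists_number_field (s : seq algC) :
  exists L, isNumberField L /\ forall x, x \in s -> L x.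
Proof.
have [Qs [QsC [s1 <- _]]] := num_field_exists s.
exists (fun x => exists y, x = QsC y); split; last by move=> _ /mapP[y _ ->]; exists y.
split.
  split; first by exists 0; rewrite rmorph0.
  split; first by exists 1; rewrite rmorph1.
  split; first by move=> _ _ [x ->] [y ->]; exists (x + y); rewrite rmorphD.
  split; first by move=> _ [x ->]; exists (- x); rewrite rmorphN.
  split; first by move=> _ _ [x ->] [y ->]; exists (x * y); rewrite rmorphM.
  by move=> _ [x ->] _; exists x^-1; rewrite fmorphV.
pose b := vbasis {:Qs}; exists [seq QsC v | v <- b].
move=> _ [y ->]; exists [seq coord b i y | i <- enum 'I_(\dim {:Qs})].
rewrite size_map size_tuple {1}(coord_vbasis (memvf y)) rmorph_sum; apply: eq_bigr => i _.
rewrite (nth_map i) ?size_enum_ord // nth_ord_enum (nth_map 0) ?size_tuple //.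
by rewrite rmorphZ_num.
Qed.

Lemma primitive_int_root (g : algC) :
  exists f : {poly int}, zcontents f = 1 /\ root (map_poly intr f) g.
Proof.
have [p [pg pm] _] := minCpolyP g.
have [f [c [c0 pE f1]]] := primitive_int_poly (monic_neq0 pm).
exists f; split => //.
have := root_minCpoly g; rewrite pg pE linearZ /= !rootE hornerZ mulf_eq0 fmorph_eq0.
rewrite (negbTE c0) /= -map_poly_comp.
by rewrite (eq_map_poly (g := intr)) // => z; rewrite /= ratr_int.
Qed.

(** By the Horner recursion, [g] times this tail is the preceding tail minus a coefficient of
    [f]. *)
Lemma denomIdeal_horner_tail (f : {poly int}) (g : algC) j :
  root (map_poly intr f) g -> denomIdeal g (drop_poly j.+1 (map_poly intr f)).[g].
Proof.
set F := map_poly _ _ => fg.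
have FZ : F \is a polyOver Aint by apply/polyOverP => i; rewrite coef_map /= Aint_int.
have DZ := Aint_horner_tail FZ fg.
split; first exact: DZ.
rewrite /Zbar mulrC -[_ * _](addKr F`_j) -drop_poly_succ addrC.
by rewrite rpredB ?DZ // (polyOverP FZ).
Qed.

Lemma isIdeal_denomIdeal (K : subsetC) (g : algC) : isSubfield K ->
  isIdeal 'O_K (fun x => denomIdeal g x /\ K x).
Proof.
move=> FK; have isK := isr_ringOfIntegers FK.
split; first by move=> x [[Zx _] Kx].
have [K0 Z0] := isr0 isK.
split; first by split=> //; split => //; rewrite /Zbar mul0r.
split.
  move=> x y [[Zx Zxg] Kx] [[Zy Zyg] Ky].
  have [Kxy Zxy] := isrD isK (conj Kx Zx) (conj Ky Zy); split => //; split => //.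
  by rewrite /Zbar mulrDl rpredD.
move=> r x [Kr Zr] [[Zx Zxg] Kx].
have [Krx Zrx] := isrM isK (conj Kr Zr) (conj Kx Zx); split => //; split => //.
by rewrite /Zbar -mulrA rpredM.
Qed.

Lemma denomIdeal_nz (K : subsetC) (g : algC) : isSubfield K ->
  exists x, (denomIdeal g x /\ K x) /\ x != 0.
Proof.
move=> FK; have isK := isr_ringOfIntegers FK.
have [f [f1 fg]] := primitive_int_root g.
have f0 : f != 0 by apply: contra_eq_neq f1 => ->; rewrite zcontents0.
exists (lead_coef f)%:~R; split; last by rewrite intr_eq0 lead_coef_eq0.
have [KZ _] := isr_int isK (lead_coef f); split => //.
have sf : (1 < size f)%N.
  apply: contraTT fg; rewrite -leqNgt => /size1_polyC fE; move: f0; rewrite fE.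
  by rewrite polyC_eq0 map_polyC rootE hornerC intr_eq0.
(* The last nonzero tail, of index [(size f).-1], is the leading coefficient of [f]. *)
have := @denomIdeal_horner_tail f g (size f).-2 fg.
have -> : (size f).-2.+1 = (size f).-1 by lia.
rewrite drop_poly_succ drop_poly_eq0; first by rewrite horner0 mulr0 addr0 coef_map.
by rewrite prednK ?(ltnW sf) // size_map_poly_id0 // intr_eq0 lead_coef_eq0.
Qed.

(** If [q] contained every [g D_(j+1)], it would contain every coefficient [f_j = D_j - g D_(j+1)],
    and the prime number [l] in [q] would divide the content of [f], which is 1. So [a = g D_(j+1)]
    and [b = D_(j+1)] work for some [j]. *)
Lemma denomIdeal_sub_prime (F q : subsetC) (g : algC) : isSubfield F -> F g ->
  nzPrime 'O_F q -> (forall x, denomIdeal g x -> F x -> q x) ->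
  exists a b, [/\ 'O_F a, ~ q a, q b, b != 0 & g = a / b].
Proof.
move=> FF Fg pq Dq; have isF := isr_ringOfIntegers FF; have idq := prime_ideal pq.
have [F0 [F1 [FD [FN [FM FV]]]]] := FF.
have [f [f1 fg]] := primitive_int_root g.
pose D j := (drop_poly j (map_poly intr f)).[g].
have FD' j : F (D j).
  rewrite /D; have : forall i, F (drop_poly j (map_poly intr f))`_i.
    by move=> i; rewrite coef_drop_poly coef_map; case: (isr_int isF (f`_(i + j))).
  elim/poly_ind: (drop_poly _ _) => [|p c IH] pF; first by rewrite horner0.
  rewrite hornerMXaddC; apply: FD; last by have := pF 0%N; rewrite coefD coefMX coefC add0r.
  apply: FM => //; apply: IH => i.
  by have := pF i.+1; rewrite coefD coefMX coefC addr0.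
have qD j : q (D j.+1) by apply: Dq => //; apply: denomIdeal_horner_tail.
have [[j nqj]|allq] := pselect (exists j, ~ q (g * D j.+1)).
  have D0 : D j.+1 != 0.
    by apply: contra_notN nqj => /eqP->; rewrite mulr0; apply: (ideal0 idq).
  exists (g * D j.+1), (D j.+1); split => //; last by rewrite mulfK.
  by have [_ ZgD] := denomIdeal_horner_tail j fg; rewrite mulrC; split => //; apply: FM.
have {}allq j : q (g * D j.+1) by apply: contrapT => nq; apply: allq; exists j.
have [l [lp ql]] := prime_has_prime isF pq.
suff : (l %| zcontents f)%Z.
  by rewrite f1 dvdzE /= dvdn1 => /eqP l1; rewrite l1 in lp.
rewrite dvdz_contents; apply/polyOverP => j.
apply: (prime_int_dvd isF pq lp ql).
(* The tail of index 0 is [f(g) = 0]; the later ones are in the denominator ideal. *)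
have qDj : q (D j).
  by case: j => [|j] //; rewrite /D drop_poly0l (rootP fg); apply: (ideal0 idq).
move: qDj; rewrite /D drop_poly_succ coef_map /= addrC.
exact/(idealDr isF idq)/allq.
Qed.

(** * Powers of a prime, negative valuations and primes in extensions *)

Section IdealPow.
Variables (R q : subsetC).
Hypothesis isR : integralSubring R.
Hypothesis pq : nzPrime R q.

Lemma idealPow_ideal n : isIdeal R (idealPow R q n).
Proof.
elim: n => [|n IH] /=; first exact: ideal_ring.
exact/(idealMul_ideal isR IH)/prime_ideal.
Qed.

Lemma idealPow_exp n x : q x -> idealPow R q n (x ^+ n).
Proof.
move=> qx; elim: n => [|n IH]; first by rewrite expr0; apply: isr1.
by rewrite exprSr; apply: idealMul_mem.
Qed.

(** Powers of a maximal ideal are primary: [d] is invertible modulo [q], hence modulo its powers. *)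
Lemma idealPow_primary n d a : R d -> ~ q d -> R a -> idealPow R q n (d * a) ->
  idealPow R q n a.
Proof.
move=> Rd nqd Ra qda; have idn := idealPow_ideal n.
have [e [Re q1]] := prime_maximal isR pq Rd nqd.
(* [(1 - d * e) ^+ n] lies in the [n]-th power of [q] and is 1 modulo [d], so [s] inverts [d] modulo
   that power. *)
have [s [Rs sE]] : exists s, R s /\ (1 - d * e) ^+ n = 1 - d * s.
  elim: n {qda idn} => [|n [s [Rs IH]]].
    by exists 0; rewrite expr0 mulr0 subr0; split => //; apply: (isr0 isR).
  exists (s + e - d * e * s); split; last by rewrite exprS IH; ring.
  by apply: (isrB isR); [apply: (isrD isR)|do 2?apply: (isrM isR)].
have -> : a = (1 - d * e) ^+ n * a + s * (d * a) by rewrite sE; ring.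
apply: (idealD idn); last exact: (idealMl idn).
exact/(idealMr idn)/idealPow_exp.
Qed.
End IdealPow.

(** For a denominator [d] outside [q], the identity [d a = (d g) b] would put [a] in every power of
    [q] containing [b]. Conversely, the fraction from [denomIdeal_sub_prime] is separated by
    exponent 1. *)
Lemma negValP (F q : subsetC) (g : algC) : isSubfield F -> F g -> nzPrime 'O_F q ->
  negVal 'O_F q g <-> (forall x, denomIdeal g x -> F x -> q x).
Proof.
move=> FF Fg pq; have isF := isr_ringOfIntegers FF; have idq := prime_ideal pq.
split=> [[a [b [Ra [Rb [b0 [gE [n [qb nqa]]]]]]]] d [Zd Zdg] Fd|].
  apply: contrapT => nqd; apply: nqa; have Rd : 'O_F d by [].
  apply: (idealPow_primary isF pq Rd nqd Ra).
  have -> : d * a = (d * g) * b by rewrite gE -mulrA divfK.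
  apply: (idealMl (idealPow_ideal isF pq n)) => //; split => //.
  by have [_ [_ [_ [_ [FM _]]]]] := FF; apply: FM.
move=> /(denomIdeal_sub_prime FF Fg pq)[a [b [Ra nqa qb b0 gE]]].
exists a, b; split => //; split; first exact: (ideal_sub idq).
split => //; split => //; exists 1%N; split.
  by have := idealPow_exp isF 1 qb; rewrite expr1.
by move=> /(idealMul_sub_r (ideal_ring isF) idq).
Qed.

(** The contraction is nonzero because [q] contains a positive integer. *)
Lemma prime_contraction (K F q : subsetC) : isSubfield K -> isSubfield F ->
  (forall x, K x -> F x) -> nzPrime 'O_F q -> nzPrime 'O_K (fun x => q x /\ 'O_K x).
Proof.
move=> FK FF KF pq; have isF := isr_ringOfIntegers FF; have idq := prime_ideal pq.
have isK := isr_ringOfIntegers FK.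
have KFO x : 'O_K x -> 'O_F x by move=> [Kx Zx]; split => //; apply: KF.
split.
  split; first by move=> x [].
  split; first by split; [apply: (ideal0 idq)|apply: (isr0 isK)].
  split; first by move=> x y [qx Kx] [qy Ky]; split; [apply: (idealD idq)|apply: (isrD isK)].
  move=> r x Kr [qx Kx]; split; last exact: (isrM isK).
  by apply: (idealMl idq) => //; apply: KFO.
split.
  have [n [n0 qn]] := ideal_has_nz_int isF idq (prime_nz pq).
  exists n%:R; rewrite pnatr_eq0 -lt0n; split => //; split => //; exact: (isr_nat isK).
split; first by move=> [/(prime_not1 pq)].
by move=> x y Kx Ky [/(primeM pq)[]] //; try exact: KFO; [left|right].
Qed.

(** A prime over [I] avoiding the complement of [p] in ['O_K] contracts into [p], hence onto [p] by
    maximality. *)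
Lemma lying_over (K F I p : subsetC) : isSubfield K -> isSubfield F ->
  (forall x, K x -> F x) -> isIdeal 'O_F I -> (exists x, I x /\ x != 0) ->
  nzPrime 'O_K p -> (forall x, I x -> K x -> p x) ->
  exists q, [/\ nzPrime 'O_F q, forall x, I x -> q x & liesOver K q p].
Proof.
move=> FK FF KF idI nzI pp Ip; have isF := isr_ringOfIntegers FF.
have isK := isr_ringOfIntegers FK.
have KFO x : 'O_K x -> 'O_F x by move=> [Kx Zx]; split => //; apply: KF.
have [||||q [pq Iq qT]] := @exists_prime_disjoint _ isF I (fun x => 'O_K x /\ ~ p x) idI nzI.
- by move=> x [Kx _]; apply: KFO.
- by split; [exact: (isr1 isK)|exact: (prime_not1 pp)].
- move=> x y [Kx px] [Ky py]; split; first exact: (isrM isK).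
  by move=> /(primeM pp)[].
- by move=> x Ix [[Kx _]]; apply; apply: Ip.
exists q; split => // x.
suff <- : (fun x => q x /\ 'O_K x) = p by [].
apply: (prime_sub_eq isK) => //; first exact: (prime_contraction FK FF).
by move=> y [qy Ky]; apply: contrapT => npy; apply: (qT y).
Qed.

Lemma liesOver_eq (K p q : subsetC) : nzPrime 'O_K q -> liesOver K q p -> q = p.
Proof.
move=> pq qp; apply/funext => x; apply/propext; rewrite -(qp x); split=> [qx|[]//].
by split=> //; apply: ideal_sub (prime_ideal pq) _ qx.
Qed.

(** Adjoining [g] to [K] changes nothing here, and the only prime over [p] is [p] itself. *)
Lemma inX_mem (K p : subsetC) (g : algC) : isSubfield K -> K g ->
  inX K g p <-> nzPrime 'O_K p /\ forall x, denomIdeal g x /\ K x -> p x.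
Proof.
move=> FK Kg; rewrite /inX (adjoin_id FK Kg); split=> -[pp H]; split=> //.
  move=> x [Dx Kx]; have pp' : liesOver K p p.
    by move=> y; split=> [[]//|py]; split=> //; apply: ideal_sub (prime_ideal pp) _ py.
  by have /(negValP FK Kg pp) := H p pp pp'; apply.
by move=> q pq /(liesOver_eq pq)->; apply/(negValP FK Kg pp) => x Dx Kx; apply: H.
Qed.

(** One direction contracts [q] to [K]; the other applies lying over to the denominator ideal in the
    larger ring, whose trace on [K] is inside [p]. *)
Lemma inYP (K p : subsetC) (g : algC) : isSubfield K ->
  inY K g p <-> nzPrime 'O_K p /\ forall x, denomIdeal g x /\ K x -> p x.
Proof.
move=> FK; have FL := isSubfield_adjoin K g; have KL := @sub_adjoin K g.
have Lg := @adjoin_mem K g; set L := adjoin K g in FL KL Lg *.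
rewrite /inY -/L; split=> -[pp H]; split => //.
  move=> x [Dx Kx]; have [q [pq [qp /(negValP FL Lg pq) Dq]]] := H.
  by apply/qp; split; [exact: Dq (KL _ Kx)|split => //; case: Dx].
have [|q [pq Dq qp]] := lying_over FK FL KL (isIdeal_denomIdeal g FL) (denomIdeal_nz g FL) pp.
  by move=> x [Dx _] Kx; apply: H.
by exists q; split => //; split => //; apply/(negValP FL Lg pq) => x Dx Lx; apply: Dq.
Qed.

Lemma principal_ideal (R : subsetC) c : integralSubring R -> R c ->
  isIdeal R (principal R c).
Proof.
move=> isR Rc.
split; first by move=> _ [r [Rr ->]]; apply: (isrM isR).
split; first by exists 0; rewrite mulr0; split => //; apply: (isr0 isR).
split.
  move=> _ _ [r [Rr ->]] [s [Rs ->]]; exists (r + s); rewrite mulrDr; split => //.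
  exact: (isrD isR).
by move=> s _ Rs [r [Rr ->]]; exists (s * r); rewrite mulrCA; split => //; apply: (isrM isR).
Qed.

(* Otherwise [0] would lie in every prime, while a prime over [l] misses an integer [n < l] of the
   denominator ideal. *)
Lemma generatingSet_nz (S : seq algC) (g : algC) : generatingSet S g -> 0 \notin S.
Proof.
move=> [SZ gS]; apply/negP => S0.
have [L [NL Lg]] := exists_number_field [:: g].
have {}Lg : L g by apply/Lg/mem_head.
have [FL _] := NL; have isL := isr_ringOfIntegers FL.
have [n [n0 Dn]] := ideal_has_nz_int isL (isIdeal_denomIdeal g FL) (denomIdeal_nz g FL).
have [l nl lp] := prime_above n.
have l0 : l%:R != 0 :> algC by rewrite pnatr_eq0 -lt0n prime_gt0.
have idl := principal_ideal isL (isr_nat isL l).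
(* With [T = {1}] this yields a prime over [l]. The ideal of [l] is proper, since [1 / l] is
   rational and would be an integer if integral. *)
have [|||||q [pq lq _]] := exists_prime_disjoint isL (T := fun x => x = 1) idl.
- exists l%:R; split => //; exists 1; rewrite mulr1; split => //; exact: (isr1 isL).
- by move=> _ ->; apply: (isr1 isL).
- by [].
- by move=> _ _ -> ->; rewrite mulr1.
- move=> _ [r [[_ Zr] ->]] lr1.
  have rE : r = l%:R^-1 by apply: (mulfI l0); rewrite lr1 divff.
  have : r \in Num.int.
    by apply: Cint_rat_Aint => //; rewrite rE rpredV rpred_nat.
  move=> /intrP[z zE]; move: lr1; rewrite zE pmulrn -intrM.
  move=> /eqP; rewrite (eqr_int _ _ 1) => /eqP/(congr1 absz); rewrite abszM => /eqP.
  by rewrite muln_eq1 => /andP[/eqP /= l1 _]; rewrite l1 in lp.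
have ql : q l%:R by apply: lq; exists 1; rewrite mulr1; split => //; apply: (isr1 isL).
have /(inX_mem q FL Lg)[_ Dq] : inX L g q.
  apply/(gS L NL q); split => //; exists 0; split => //; exact: (ideal0 (prime_ideal pq)).
have qn : q (n%:Z)%:~R by apply: Dq.
have := prime_int_dvd isL pq lp ql qn.
by rewrite dvdzE /= => /(dvdn_leq n0); rewrite leqNgt nl.
Qed.

Lemma principal_mem (R : subsetC) c : integralSubring R -> principal R c c.
Proof. by move=> isR; exists 1; rewrite mulr1; split => //; apply: (isr1 isR). Qed.

Lemma principal_sub (R I : subsetC) c : integralSubring R -> isIdeal R I ->
  (forall x, principal R c x -> I x) <-> I c.
Proof.
move=> isR idI; split=> [|Ic _ [r [Rr ->]]]; first by apply; apply: principal_mem.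
exact: (idealMr idI).
Qed.

Lemma prod_mem_prime (R p : subsetC) (S : seq algC) (P : pred algC) :
  integralSubring R -> nzPrime R p -> (forall a, a \in S -> P a -> R a) ->
  p (\prod_(a <- S | P a) a) <-> exists a, [/\ a \in S, P a & p a].
Proof.
move=> isR pp SR; split; first exact: (prime_prod isR pp).
move=> [a [aS Pa pa]]; rewrite (big_rem a) //= Pa; apply: (idealMr (prime_ideal pp)) => //.
rewrite big_seq_cond; apply: (big_ind R) => [||b /andP[/mem_rem bS Pb]].
- exact: (isr1 isR).
- exact: (isrM isR).
- exact: SR.
Qed.

(** * Generating sets and the three radical identities *)

Section Main.
Variables (g : algC) (S : seq algC).
Hypothesis gS : generatingSet S g.

Lemma prod_generatingSet_nz (P : pred algC) : \prod_(a <- S | P a) a != 0.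
Proof.
rewrite prodf_seq_neq0; apply/allP => a aS; apply/implyP => _.
by apply: contraNneq (generatingSet_nz gS) => <-.
Qed.

(** The generating property concerns number fields only, so [p] is contracted to a number field [L]
    containing [g] and [S]. *)
Lemma denomIdeal_sub_Zbar_prime p : nzPrime Zbar p ->
  (forall x, denomIdeal g x -> p x) <-> exists a, a \in S /\ p a.
Proof.
have [L [NL LgS]] := exists_number_field (g :: S).
have Lg : L g by apply/LgS/mem_head.
have LS a : a \in S -> L a by move=> aS; apply: LgS; rewrite inE aS orbT.
have [FL _] := NL; have isL := isr_ringOfIntegers FL.
have [SZ /(_ L NL) gSL] := gS.
rewrite -Zbar_top => pp; set p' := fun x => p x /\ 'O_L x.
have pp' : nzPrime 'O_L p' by apply: (prime_contraction FL isSubfield_top).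
have := gSL p'; rewrite (inX_mem p' FL Lg) => H.
split=> [Dp|[a [aS pa]]].
  have [|_ [a [aS [pa _]]]] := H.1; last by exists a.
  split => // x [Dx Lx]; split; first exact: Dp.
  by split => //; case: Dx.
have [|_ Dp'] := H.2.
  by split => //; exists a; split => //; split => //; split; [apply: LS|apply: SZ].
(* [p'] only sees denominators in [L]. With [g = u / v], [u] outside [p] and [v] in [p], any
   denominator [d] satisfies [d u = (d g) v] in [p], hence lies in [p]. *)
have [|u [v [Lu nu [pv _] v0 gE]]] := denomIdeal_sub_prime FL Lg pp'.
  by move=> x Dx Lx; apply: Dp'.
move=> d [Zd Zdg].
have : p (d * u).
  have -> : d * u = (d * g) * v by rewrite gE -mulrA divfK.
  by apply: (idealMl (prime_ideal pp)).
case/(primeM pp) => // [|pu]; first by split=> //; case: Lu.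
by case: nu.
Qed.

End Main.

Theorem mainTheorem18 (g : algC) (S : seq algC) :
  uniq S -> generatingSet S g ->
  sameIdeal (radical Zbar (denomIdeal g))
            (radical Zbar (principal Zbar (\prod_(a <- S) a))) /\
  (forall K : algC -> Prop, isNumberField K ->
     (exists ps, enumerates (inY K g) ps /\
        sameIdeal (radical (ringOfIntegers K) (fun x => denomIdeal g x /\ K x))
                  (prodIdeals (ringOfIntegers K) ps)) /\
     (exists ps, enumerates (inX K g) ps /\
        sameIdeal (radical (ringOfIntegers K)
                     (principal (ringOfIntegers K) (\prod_(a <- S | `[< K a >]) a)))
                  (prodIdeals (ringOfIntegers K) ps))).
Proof.
move=> _ gS; have [SZ gSL] := gS; have S0 := prod_generatingSet_nz gS; split.
  have isT := isr_ringOfIntegers isSubfield_top; rewrite Zbar_top in isT.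
  have idD : isIdeal Zbar (denomIdeal g).
    have := isIdeal_denomIdeal g isSubfield_top; rewrite Zbar_top.
    by have -> : (fun x => denomIdeal g x /\ True) = denomIdeal g
      by apply/funext => x; rewrite andB.
  have nzD : exists x, denomIdeal g x /\ x != 0.
    by have [x [[Dx _] x0]] := denomIdeal_nz g isSubfield_top; exists x.
  have Zprod : Zbar (\prod_(a <- S) a).
    by rewrite /Zbar big_seq; apply: rpred_prod => a /SZ.
  move=> x; have [Zx|nZx] := pselect (Zbar x); last by split => -[].
  rewrite !radicalP //; first last.
  - by exists (\prod_(a <- S) a); split; [apply: principal_mem|apply: S0].
  - exact: principal_ideal.
  (* It suffices that the same primes contain both ideals; a prime contains the product exactly when
     it meets [S]. *)
  have sub p : nzPrime Zbar p -> (forall y, denomIdeal g y -> p y) <->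
      (forall y, principal Zbar (\prod_(a <- S) a) y -> p y).
    move=> pp; rewrite (principal_sub _ isT (prime_ideal pp)).
    rewrite (denomIdeal_sub_Zbar_prime gS pp) (prod_mem_prime isT pp); last by move=> a /SZ.
    by split=> [[a [aS pa]]|[a [aS _ pa]]]; exists a.
  by split=> H p pp /(sub p pp); apply: H.
move=> K NK; have [FK [bs spanK]] := NK; have isK := isr_ringOfIntegers FK.
have spanO x : 'O_K x -> exists rs : seq rat,
    x = \sum_(i < size bs) ratr (nth 0 rs i) * bs`_i by move=> [/spanK].
(* Common form of the two identities in ['O_K]: only the primes above [I] remain to be
   identified. *)
have main I P : isIdeal 'O_K I -> (exists y, I y /\ y != 0) ->
    (forall p, P p <-> nzPrime 'O_K p /\ forall y, I y -> p y) ->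
    exists ps, enumerates P ps /\ sameIdeal (radical 'O_K I) (prodIdeals 'O_K ps).
  move=> idI nzI PE; have [ps psE] := enumeration_primes_over isK spanO idI nzI.
  have <- : (fun p => nzPrime 'O_K p /\ forall y, I y -> p y) = P.
    by apply/funext => p; apply/propext; rewrite PE.
  by exists ps; split => //; apply: (enumerates_radical isK idI nzI) psE.
have SKO a : a \in S -> `[< K a >] -> 'O_K a by move=> aS /asboolP Ka; split=> //; apply: SZ.
set c := \prod_(a <- S | `[< K a >]) a.
have Kc : 'O_K c.
  rewrite /c big_seq_cond; apply: (big_ind 'O_K) => [||a /andP[]]; last exact: SKO.
    exact: (isr1 isK).
  exact: (isrM isK).
split; apply: main.
- exact: isIdeal_denomIdeal.
- exact: denomIdeal_nz.
- by move=> p; apply: inYP.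
- exact: principal_ideal.
- by exists c; split; [apply: principal_mem|apply: S0].
(* A prime of ['O_K] meeting [S] does so in an element of [K], which is thus a factor of [c]. *)
move=> p; rewrite (gSL K NK p); split=> -[pp H]; split=> //.
  apply/(principal_sub _ isK (prime_ideal pp))/(prod_mem_prime isK pp SKO).
  have [a [aS pa]] := H; exists a; split=> //; apply/asboolP.
  by have [] := ideal_sub (prime_ideal pp) pa.
move: H; rewrite (principal_sub _ isK (prime_ideal pp)) (prod_mem_prime isK pp SKO).
by move=> [a [aS _ pa]]; exists a.
Qed.
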